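(* Let $G$ be a finite non-abelian group (written additively) of even order $n$ which possesses a subgroup of index $2$. Then (i) if $n=6$, then $cr(G)=4$ (here $G$ is the symmetric group $S_3$); (ii) otherwise, $cr(G)=n/2$.
   Context: For a subset $S=\{a_1,\dots,a_k\}$ of a finite additively written group $G$, $\sum(S)$ denotes the set of all elements $a_{i_1}+\cdots+a_{i_l}$ with $1\le l\le k$ and $i_1,\dots,i_l$ pairwise distinct indices (in any order). The critical number $cr(G)$ is the smallest integer $t$ such that every subset $S\subseteq G\setminus\{0\}$ with $|S|\ge t$ satisfies $\sum(S)=G$. *)

(* Defs.v *)
From mathcomp Require Import all_boot all_fingroup.
Set Implicit Arguments. Unset Strict Implicit. Unset Printing Implicit Defensive.
Local Open Scope group_scope.

(* The group operation is written multiplicatively (MathComp convention);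
   the paper's "a_{i_1} + ... + a_{i_l}" is the product of the sequence. *)

Definition in_sigma (gT : finGroupType) (S : {set gT}) (g : gT) : Prop :=
  exists s : seq gT, [/\ uniq s, s != [::], {subset s <= S} & g = \prod_(x <- s) x].

Definition sigma_full (gT : finGroupType) (G : {set gT}) (S : {set gT}) : Prop :=
  forall g, g \in G -> in_sigma S g.

Definition cr_prop (gT : finGroupType) (G : {set gT}) (t : nat) : Prop :=
  forall S : {set gT}, S \subset G :\ 1 -> t <= #|S| -> sigma_full G S.

Definition is_cr (gT : finGroupType) (G : {set gT}) (t : nat) : Prop :=
  cr_prop G t /\ forall t', cr_prop G t' -> t <= t'.

(* Main.v *)
Require Import Defs.
From mathcomp Require Import all_boot all_fingroup all_solvable.
From Stdlib Require Import Classical.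

(* Let H be the subgroup of index 2, m = |H|, S0 = S :&: H, S1 = S :\: H and
   K = S0 with 1 added, so that |K| + |S1| = |S| + 1. For |S| >= m and g
   outside H, the subsets K and g S1^-1 of H meet, so g is an element of S1 or
   a product of two elements of S. For g in H and c in S1, the subsets K and
   g c^-1 (S1 \ c)^-1 of H have |S| elements together, so they meet unless
   |S| = m and they are complementary in H.

   In that last case, if g is not reached, then K contains every product of
   distinct elements of S0 (otherwise K could be enlarged), and y in G \ H but
   not in S1 gives an injection c |-> g c^-1 y^-1 of S1 into K, so that
   2|K| > m unless S0 is empty. If |S0| >= 3 then K is a subgroup, hence K = H
   and g is a product of elements of H \ 1. If |S0| = 2 then m is 4 or 5 and
   one is led to the quaternion group, where a commutator gives g. If |S0| = 1
   then m <= 3, which is excluded. If S0 is empty then every c outside H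
   satisfies c^2 = g, so H is abelian and inverted by c, and g is a product of
   four elements outside H. *)

Set Implicit Arguments.
Unset Strict Implicit.
Unset Printing Implicit Defensive.
Local Open Scope group_scope.

(** * Products of distinct elements of a subset *)

Section SubsetProducts.
Variable gT : finGroupType.
Implicit Types (S A B K : {set gT}) (s : seq gT).

Lemma in_sigma_prod S s :
  uniq s -> s != [::] -> all [in S] s -> in_sigma S (\prod_(x <- s) x).
Proof. by move=> us s0 /allP sS; exists s; split. Qed.

Lemma in_sigma1 S a : a \in S -> in_sigma S a.
Proof.
move=> aS; have := @in_sigma_prod S [:: a]; rewrite big_seq1; apply=> //=.
by rewrite aS.
Qed.

Lemma in_sigma2 S a b : a \in S -> b \in S -> a != b -> in_sigma S (a * b).
Proof.
move=> aS bS ab; have := @in_sigma_prod S [:: a; b].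
by rewrite !big_cons big_nil mulg1; apply; rewrite //= ?inE ?aS ?bS ?ab.
Qed.

Lemma in_sigma3 S a b c : a \in S -> b \in S -> c \in S ->
  a != b -> a != c -> b != c -> in_sigma S (a * b * c).
Proof.
move=> aS bS cS ab ac bc; have := @in_sigma_prod S [:: a; b; c].
rewrite !big_cons big_nil mulg1 mulgA; apply=> //=.
  by rewrite !inE negb_or ab ac bc.
by rewrite aS bS cS.
Qed.

Lemma in_sigma4 S a b c d : a \in S -> b \in S -> c \in S -> d \in S ->
  a != b -> a != c -> a != d -> b != c -> b != d -> c != d ->
  in_sigma S (a * b * c * d).
Proof.
move=> aS bS cS dS ab ac ad bc bd cd.
have := @in_sigma_prod S [:: a; b; c; d].
rewrite !big_cons big_nil mulg1 !mulgA; apply=> //=.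
  by rewrite !inE !negb_or ab ac ad bc bd cd.
by rewrite aS bS cS dS.
Qed.

(** The factors of [w] lie in [A], so [b] and [c] cannot repeat any of them. *)
Lemma in_sigma_cat2 S A w b c : in_sigma A w -> A \subset S ->
  b \in S :\: A -> c \in S :\: A -> b != c -> in_sigma S (w * (b * c)).
Proof.
case=> s [us s0 sA ->] sAS /setDP[bS bA] /setDP[cS cA] bc.
have := @in_sigma_prod S (s ++ [:: b; c]).
rewrite big_cat /= !big_cons big_nil mulg1; apply.
- rewrite cat_uniq us /= inE bc orbF andbT negb_or.
  by rewrite (contra (sA _) bA) (contra (sA _) cA).
- by case: (s).
- rewrite all_cat /= bS cS !andbT; apply/allP => x /sA; exact: (subsetP sAS).
Qed.

Lemma card_meet A B (X : {set gT}) : A \subset X -> B \subset X ->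
  #|X| < #|A| + #|B| -> exists2 x, x \in A & x \in B.
Proof.
move=> AX BX lt; case: (set_0Vmem (A :&: B)) => [AB0|[x /setIP[]]];
  last by exists x.
move: lt; rewrite -cardsUI AB0 cards0 addn0 ltnNge subset_leq_card //.
by rewrite subUset AX.
Qed.

(* With [c = a * b] for [a, b] in [K] distinct and not mutually inverse, the
   product [a * b * c = c ^+ 2] has distinct factors. Hence [c * K = K], and
   the square of any [x] in [K] is the product of [c], [c^-1 * x] and [x]. *)
Lemma sigma_closed_group K : 1 \notin K -> 2 < #|K| ->
  (forall w, in_sigma K w -> w \in 1 |: K) -> group_set (1 |: K).
Proof.
move=> K1 cK clK.
have ne1 x : x \in K -> x != 1 by apply: contraTneq => ->.
have cl2 x y : x \in K -> y \in K -> x != y -> x * y \in 1 |: K.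
  by move=> xK yK xy; apply: clK; apply: in_sigma2.
have [a aK] : exists a, a \in K.
  by apply/set0Pn; rewrite -card_gt0; apply: leq_trans cK.
have [b] : exists b, b \in K :\: [set a; a^-1].
  apply/set0Pn; rewrite -card_gt0 cardsD subn_gt0.
  apply: leq_ltn_trans cK; apply: leq_trans (subset_leq_card (subsetIr _ _)) _.
  by rewrite cards2; case: (_ != _).
rewrite !inE negb_or => /andP[/andP[ba bV] bK].
pose c := a * b.
have c1 : c != 1 by rewrite /c -eq_invg_mul eq_sym.
have ca : c != a by rewrite /c -{2}(mulg1 a) (inj_eq (mulgI a)) ne1.
have cb : c != b by rewrite /c -{2}(mul1g b) (inj_eq (mulIg b)) ne1.
have cK' : c \in K.
  by have := cl2 a b aK bK; rewrite eq_sym ba !inE -/c (negPf c1) => /(_ isT).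
have ccK : c * c \in 1 |: K.
  by rewrite {1}/c; apply: clK; apply: in_sigma3 => //; rewrite eq_sym.
have cmul k : k \in 1 |: K -> c * k \in 1 |: K.
  case/setU1P => [->|kK]; first by rewrite mulg1 setU1r.
  by have [<-|kc] := eqVneq c k; last exact: cl2.
have cX i k : k \in 1 |: K -> c ^+ i * k \in 1 |: K.
  move=> kK; elim: i => [|i IH]; first by rewrite mul1g.
  by rewrite expgS -mulgA cmul.
have sq x : x \in K -> x * x \in 1 |: K.
  move=> xK; pose e := c^-1 * x.
  have xe : x = c * e by rewrite /e mulKVg.
  have eK : e \in 1 |: K by rewrite /e invg_expg cX // !inE xK orbT.
  have [e1|e1] := eqVneq e 1; first by rewrite xe e1 mulg1.
  have [ec|ec] := eqVneq e c.
    by rewrite xe ec -mulgA; do 3!apply: (cmul); rewrite setU1r.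
  move: eK; rewrite !inE (negPf e1) /= => eK.
  have := clK (c * e * x); rewrite -xe !inE; apply.
  rewrite {1}xe; apply: in_sigma3 => //; first by rewrite eq_sym.
    by rewrite xe -{1}(mulg1 c) (inj_eq (mulgI c)) eq_sym.
  by rewrite xe -{1}(mul1g e) (inj_eq (mulIg e)) eq_sym.
apply/group_setP; split=> [|x y]; first exact: setU11.
case/setU1P => [->|xK]; first by rewrite mul1g.
case/setU1P => [->|yK]; first by rewrite mulg1 setU1r.
have [->|] := eqVneq x y; [exact: sq | exact: cl2].
Qed.

End SubsetProducts.

(** * Coset arithmetic for a subgroup of index two *)

Section IndexTwo.
Variables (gT : finGroupType) (G H : {group gT}).
Hypotheses (sHG : H \subset G) (iHG : #|G : H| = 2).

Lemma card_index2 : #|G| = #|H|.*2.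
Proof. by rewrite -(Lagrange sHG) iHG muln2. Qed.

Lemma card_outside : #|G :\: H| = #|H|.
Proof.
by rewrite cardsD (setIidPr sHG) card_index2 -addnn addnK.
Qed.

Lemma outsideV x : x \in G :\: H -> x^-1 \in G :\: H.
Proof. by rewrite !inE !groupV. Qed.

Lemma insideM h x : h \in H -> x \in G :\: H -> h * x \in G :\: H.
Proof.
move=> hH; rewrite !inE groupMl // => /andP[-> xG].
by rewrite groupM // (subsetP sHG).
Qed.

Lemma outsideM x y : x \in G :\: H -> y \in G :\: H -> x * y \in H.
Proof.
(* The coset [H :* y^-1] lies outside [H] and has the size of the whole complement, so [x] belongs
   to it. *)
move=> xN yN; have /setP/(_ x) : H :* y^-1 = G :\: H.
  apply/eqP; rewrite eqEcard card_rcoset card_outside leqnn andbT.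
  by apply/subsetP => z /rcosetP[h hH ->]; rewrite insideM ?outsideV.
by rewrite xN mem_rcoset invgK.
Qed.

Lemma insideMr h x : h \in H -> x \in G :\: H -> x * h \in G :\: H.
Proof.
move=> hH xN; rewrite -[x * h]invgK invMg.
by rewrite outsideV ?insideM ?groupV ?outsideV.
Qed.

Lemma abelian_index2 x :
  abelian H -> x \in G :\: H -> (forall h, h \in H -> commute x h) -> abelian G.
Proof.
move=> abH xN xH.
have dec y : y \in G -> exists h, h \in H /\ (y = h \/ y = h * x).
  move=> yG; have [yH|yH] := boolP (y \in H); first by exists y; split; [|left].
  have yN : y \in G :\: H by rewrite inE yH.
  exists (y * x^-1); rewrite mulgKV; split; last by right.
  exact: outsideM yN (outsideV xN).
have cx h : h \in H -> commute h x by move=> /xH /commute_sym.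
have cH h k : h \in H -> k \in H -> commute h k.
  by move=> hH kH; apply: (centsP abH).
apply/centsP => y /dec[h [hH hE]] z /dec[k [kH kE]].
have cxk := xH k kH; have chk := cH h k hH kH; have chx := cx h hH.
case: hE => ->; case: kE => -> //.
- exact: commuteM.
- by apply: commute_sym; apply: commuteM; apply: commute_sym.
- by apply: commuteM; apply: commute_sym; apply: commuteM.
Qed.

(** The element [x * x] of [H] is nontrivial, so it generates [H], and [x] commutes with its
    powers. *)
Lemma abelian_prime_index2 x :
  prime #|H| -> x \in G :\: H -> x * x != 1 -> abelian G.
Proof.
move=> prH xN xx1.
apply: (abelian_index2 (cyclic_abelian (prime_cyclic prH)) xN) => h hH.
have : H \subset <[x * x]>.
  by rewrite prime_meetG // (setIidPr _) ?cycle_subG ?cycle_eq1 // outsideM.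
move/subsetP/(_ h hH)/cycleP => [i ->]; apply: commuteX.
by rewrite /commute mulgA.
Qed.

(** * Pigeonhole in [H] for a subset with at least half the elements of [G] *)

Section LargeSubset.
Variable S : {set gT}.
Hypothesis sSG : S \subset G :\ 1.

Let S0 := S :&: H.
Let S1 := S :\: H.
Let K := 1 |: S0.

Lemma subset_neq1 x : x \in S -> x != 1.
Proof. by move/(subsetP sSG); rewrite !inE => /andP[]. Qed.

Lemma S1_outside : S1 \subset G :\: H.
Proof. by rewrite setSD // (subset_trans sSG) ?subsetDl. Qed.

Lemma S0_not1 : 1 \notin S0.
Proof. by apply/negP => /setIP[/subset_neq1]; rewrite eqxx. Qed.

Lemma K_inside : K \subset H.
Proof. by rewrite subUset sub1set group1 subsetIr. Qed.

Lemma card_K : #|K| = #|S0|.+1.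
Proof. by rewrite cardsU1 S0_not1. Qed.

Lemma card_S : #|S| = #|S0| + #|S1|.
Proof. by rewrite cardsID. Qed.

Lemma in_sigma_K w : w \in K -> w = 1 \/ in_sigma S0 w.
Proof. by case/setU1P => [->|wS]; [left | right; exact: in_sigma1]. Qed.

Lemma in_sigma_two_outside w b c : w = 1 \/ in_sigma S0 w ->
  b \in S1 -> c \in S1 -> b != c -> in_sigma S (w * (b * c)).
Proof.
move=> w0 bS cS bc; have sub x : x \in S1 -> x \in S :\: S0.
  by rewrite !inE => /andP[/negPf-> ->].
case: w0 => [->|w0]; last first.
  exact: in_sigma_cat2 w0 (subsetIl _ _) (sub _ bS) (sub _ cS) bc.
case/setDP: bS cS => bS _ /setDP[cS _].
by rewrite mul1g; apply: in_sigma2.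
Qed.

Lemma sigma_outside g : #|H| <= #|S| -> g \in G :\: H -> in_sigma S g.
Proof.
move=> cS gN; have AH : g *: S1^-1 \subset H.
  apply/subsetP => _ /lcosetP[y yS ->]; apply: outsideM => //.
  by rewrite -[y]invgK outsideV // (subsetP S1_outside) // -mem_invg.
case: (card_meet K_inside AH).
  by rewrite card_K card_lcoset card_invg addSn -card_S ltnS.
move=> x /setU1P xK; rewrite mem_lcoset mem_invg invMg invgK => bS1.
have [bS bH] := setDP bS1; case: xK => [xE|/setIP[xS xH]].
  by apply: in_sigma1; move: bS; rewrite xE invg1 mul1g.
rewrite -(mulKVg x g); apply: in_sigma2 => //.
by apply: contraNneq bH => <-.
Qed.

(** [B] and [L] are kept general because the critical case enlarges either [S1 :\ c] or [K] by one
    element. *)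
Lemma outside_pigeonhole g c (B L : {set gT}) :
  g \in H -> c \in S1 -> B \subset G :\: H -> L \subset H ->
  #|H| < #|L| + #|B| ->
  exists2 b, b \in B & g * c^-1 * b^-1 \in L.
Proof.
move=> gH cS BN LH lt.
have gcN : g * c^-1 \in G :\: H.
  by rewrite insideM // outsideV // (subsetP S1_outside).
have AH : (g * c^-1) *: B^-1 \subset H.
  apply/subsetP => _ /lcosetP[y yB ->]; apply: outsideM => //.
  by rewrite -[y]invgK outsideV // (subsetP BN) // -mem_invg.
case: (card_meet LH AH); first by rewrite card_lcoset card_invg.
move=> x xL /lcosetP[y yB xE]; exists y^-1; first by rewrite -mem_invg.
by rewrite invgK -xE.
Qed.

Lemma S1_neq0 : #|H| <= #|S| -> exists c, c \in S1.
Proof.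
move=> cS; apply/set0Pn; apply: contraTneq cS => S10.
rewrite card_S S10 cards0 addn0 -ltnNge -card_K subset_leq_card //.
exact: K_inside.
Qed.

Lemma S1D1_outside c : S1 :\ c \subset G :\: H.
Proof. exact: subset_trans (subsetDl _ _) S1_outside. Qed.

Lemma card_S1D1 c : c \in S1 -> #|S1| = #|S1 :\ c|.+1.
Proof. by move=> cS; rewrite (cardsD1 c) cS. Qed.

Lemma sigma_inside_pigeonhole g c w b :
  w = 1 \/ in_sigma S0 w -> c \in S1 -> b \in S1 :\ c ->
  g * c^-1 * b^-1 = w -> in_sigma S g.
Proof.
move=> w0 cS /setD1P[bc bS] E.
have -> : g = w * (b * c) by rewrite -E -!mulgA mulKg mulVg mulg1.
exact: in_sigma_two_outside.
Qed.

Lemma sigma_inside_large g : #|H| < #|S| -> g \in H -> in_sigma S g.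
Proof.
move=> cS gH; have [c cS1] := S1_neq0 (ltnW cS).
case: (outside_pigeonhole gH cS1 (S1D1_outside c) K_inside).
  by rewrite card_K addSnnS -card_S1D1 // -card_S.
move=> b bS1 bK; exact: (sigma_inside_pigeonhole (in_sigma_K bK) cS1 bS1 erefl).
Qed.

(** * The critical case: exactly half the elements, and some [g] in [H] not reached *)

Section Critical.
Variable g : gT.
Hypotheses (cS : #|S| = #|H|) (gH : g \in H) (Ng : ~ in_sigma S g).

Lemma sigma_S0_in_K w : in_sigma S0 w -> w \in K.
Proof.
move=> w0; have [c cS1] : exists c, c \in S1 by apply: S1_neq0; rewrite cS.
have wH : w \in H.
  case: w0 => s [_ _ sS ->]; rewrite big_seq; apply: group_prod => x /sS.
  by case/setIP.
apply/idPn => wK; case: Ng.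
(* Adding [w] to [K] brings the two sizes to |H| + 1, which forces a representation of [g]. *)
have LH : w |: K \subset H by rewrite subUset sub1set wH K_inside.
case: (outside_pigeonhole gH cS1 (S1D1_outside c) LH).
  rewrite cardsU1 wK card_K add1n !addSn addnC -addSn -card_S1D1 // addnC.
  by rewrite -card_S cS.
move=> b bS1 /setU1P[bE|bK].
  by apply: (sigma_inside_pigeonhole (or_intror w0) cS1 bS1).
exact: (sigma_inside_pigeonhole (in_sigma_K bK) cS1 bS1 erefl).
Qed.

(** Here [S1 :\ c] is enlarged by [z]. The forced meeting point must come from [z], since any other
    would reach [g]. The choice [z = c] is allowed and controls squares. *)
Lemma quotient_in_K c z :
  c \in S1 -> z \in G :\: H -> z \notin S1 :\ c -> g * c^-1 * z^-1 \in K.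
Proof.
move=> cS1 zN zS.
have BN : z |: S1 :\ c \subset G :\: H.
  by rewrite subUset sub1set zN S1D1_outside.
case: (outside_pigeonhole gH cS1 BN K_inside).
  by rewrite card_K cardsU1 zS add1n -card_S1D1 // addSn -card_S cS.
move=> b /setU1P[->//|bS1] bK; case: Ng.
exact: (sigma_inside_pigeonhole (in_sigma_K bK) cS1 bS1 erefl).
Qed.

Lemma quotient_notin_K b c :
  b \in S1 -> c \in S1 -> b != c -> g * c^-1 * b^-1 \notin K.
Proof.
move=> bS cS1 bc; apply/negP => bK; case: Ng.
apply: (sigma_inside_pigeonhole (in_sigma_K bK) cS1 _ erefl).
by rewrite !inE bc -in_setD.
Qed.

Lemma card_S1_le : #|S1| < #|H| -> #|S1| <= #|K|.
Proof.
move=> lt; have [z] : exists z, z \in (G :\: H) :\: S1.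
  apply/set0Pn; rewrite -card_gt0 cardsD subn_gt0 (setIidPr S1_outside).
  by rewrite card_outside.
case/setDP => zN zS.
rewrite -(card_invg S1) -(card_lcoset S1^-1 g) -(card_rcoset _ z^-1).
apply/subset_leq_card/subsetP => _ /rcosetP[_ /lcosetP[y yS ->] ->].
rewrite -[y]invgK quotient_in_K //; first by rewrite -mem_invg.
by rewrite !inE; apply: contra zS => /andP[_]; rewrite -in_setD.
Qed.

Hypothesis nabG : ~~ abelian G.

Lemma critical_S0_0 : 3 < #|H| -> S0 = set0 -> False.
Proof.
move=> cH S00; have S1E : S1 = G :\: H.
  apply/eqP; rewrite eqEcard S1_outside card_outside // -cS card_S S00.
  by rewrite cards0 add0n leqnn.
have NS x : x \in G :\: H -> x \in S by rewrite -S1E => /setDP[].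
have sq c : c \in G :\: H -> c * c = g.
  move=> cN; have cS1 : c \in S1 by rewrite S1E.
  have := quotient_in_K cS1 cN; rewrite setD11 /K S00 setU0 => /(_ isT)/set1P E.
  by apply/esym; rewrite -[RHS]mul1g -E mulgA !mulgKV.
have [b bS1] : exists b, b \in S1 by apply: S1_neq0; rewrite cS.
have bN : b \in G :\: H by rewrite -S1E.
(* Comparing (b h)^2 = g with b^2 = g shows that [b] inverts [H]. *)
have inv h : h \in H -> h * b * h = b.
  move=> hH; have := sq _ (insideMr hH bN); rewrite -(sq b bN) -!mulgA.
  by move/mulgI.
have cHH h u : h \in H -> u \in H -> h * u = u * h.
  move=> hH uH; have := inv _ (groupM hH uH).
  rewrite -{2}(inv h hH) -{2}(inv u uH).
  by rewrite -!mulgA => /mulgI/mulgI/mulgI.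
have abH : abelian H by apply/centsP => h hH u uH; exact: cHH.
(* As a power of [b], [g] commutes with [b], yet [b] inverts it. *)
have g2 : g * g = 1.
  have gb : g * b = b * g by rewrite -(sq b bN) mulgA.
  have := inv g gH; rewrite gb -mulgA -{2}(mulg1 b).
  by move/mulgI.
(* Otherwise inversion is trivial on [H], so [b] centralizes [H] and [G] is abelian. *)
have [u uH u2] : exists2 u, u \in H & u * u != 1.
  case: (boolP [exists u in H, u * u != 1]) => [/exists_inP //|].
  move/exists_inPn => sq1.
  case/negP: nabG; apply: (abelian_index2 abH bN) => u uH.
  have /negPn/eqP uu := sq1 u uH.
  by rewrite /commute -{1}(inv u uH) -mulgA uu mulg1.
(* [h] avoiding [s] makes the factors [b], [b * u], [b * h] and
   [b * (h * u^-1 * g)] below distinct; [s] cannot exhaust [H], because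
   [u * u] would have to be in [s]. *)
pose s := [:: 1; u; u * g; u * u * g].
have [h hH hs] : exists2 h, h \in H & h \notin s.
  apply: NNPP => nh; have sub : {subset enum H <= s}.
    move=> h; rewrite mem_enum => hH; apply/idPn => hs; case: nh; by exists h.
  (* [H] has at least four elements, all among the four entries of [s]; this excludes [g = 1]
     below. *)
  have us : uniq s.
    by apply: (leq_size_uniq (enum_uniq H) sub); rewrite -cardE.
  have : u * u \in s by apply: sub; rewrite mem_enum groupM.
  rewrite !inE (negPf u2) /= => /or3P[] /eqP E.
  - have /mulgI u1 : u * u = u * 1 by rewrite mulg1.
    by rewrite u1 mulg1 eqxx in u2.
  - by rewrite (mulgI _ _ _ E) g2 eqxx in u2.
  - have /mulgI g1 : u * u * g = u * u * 1 by rewrite mulg1 -E.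
    by move: us; rewrite /s g1 /= !mulg1 !inE eqxx !(orbT, andbF, andFb).
move: hs; rewrite !inE !negb_or => /and4P[h1 hu hug huug].
have u1 : u != 1 by apply: contraNneq u2 => ->; rewrite mulg1.
have ug : u != g by apply: contraNneq u2 => ->; rewrite g2.
case: Ng.
(* The squares b^2 and (b h)^2 both equal g, leaving g u g u^-1 g = g^3 = g. *)
have -> : g = b * (b * u) * (b * h) * (b * (h * u^-1 * g)).
  have -> : b * (b * u) * (b * h) * (b * (h * u^-1 * g))
     = (b * b) * u * ((b * h) * (b * h)) * u^-1 * g by rewrite !mulgA.
  by rewrite !sq // ?insideMr // (cHH g u) // -(mulgA u) g2 mulg1 mulgV mul1g.
have gV : g^-1 = g by rewrite -[RHS]mul1g -(mulVg g) -mulgA g2 mulg1.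
have neq x y : (b * x != b * y) = (x != y) by rewrite (inj_eq (mulgI b)).
have neq1 y : (b != b * y) = (y != 1) by rewrite -{1}(mulg1 b) neq eq_sym.
apply: in_sigma4; rewrite ?neq ?neq1 ?NS ?insideMr ?groupM ?groupV //.
- apply: contraNneq hug => E; rewrite -(mulgKV u h) -(mulgK g (h * u^-1)) E.
  by rewrite mul1g gV cHH.
- by rewrite eq_sym.
- apply: contraNneq huug => E; rewrite -(mulgKV u h) -(mulgK g (h * u^-1)) -E.
  by rewrite gV -!mulgA (cHH g u).
- rewrite -{1}(mulg1 h) -mulgA (inj_eq (mulgI h)).
  by apply: contraNneq ug => E; rewrite -(mulg1 u) E mulKVg.
Qed.

Lemma critical_S0_large : 2 < #|S0| -> False.
Proof.
move=> S0gt2; have gK := sigma_closed_group S0_not1 S0gt2 sigma_S0_in_K.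
have cSS : #|S0| + #|S1| = #|H| by rewrite -card_S cS.
have KH : K = H.
  have S1H : #|S1| < #|H|.
    by rewrite -cSS -{1}(add0n #|S1|) ltn_add2r; case: #|S0| S0gt2.
  have KS := card_S1_le S1H.
  apply/eqP; rewrite eqEcard K_inside /=.
  (* [q] is the index of the subgroup [K] in [H]; |S1| <= |K| makes it less than 2. *)
  have /dvdnP[q qE] : #|K| %| #|H| := cardSg (K_inside : Group gK \subset H).
  have K0 : 0 < #|K| by rewrite card_K.
  have : q < 2.
    rewrite -(ltn_pmul2r K0) -qE mul2n -addnn -cSS {1}card_K addSn ltnS.
    by rewrite leq_add2l.
  by case: q qE => [|[|]] // E _; move: (cardG_gt0 H); rewrite E ?mul0n ?mul1n.
have inS0 h : h \in H -> h != 1 -> h \in S0.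
  by rewrite -KH => /setU1P[->|//]; rewrite eqxx.
have sub h : h \in S0 -> h \in S by case/setIP.
have subH h : h \in S0 -> h \in H by case/setIP.
have [g1|g1] := eqVneq g 1; last by case: Ng; apply/in_sigma1/sub/inS0.
(* Only [g = 1] remains: it is a a^-1 if some [a] is not its own inverse, and otherwise a b (a b)
   with three distinct factors. *)
case: (boolP [exists a in S0, a^-1 != a]) =>
    [/exists_inP[a aS0 aV]|/exists_inPn invS0].
  have aVS0 : a^-1 \in S0.
    rewrite inS0 ?groupV ?subH // eq_invg1.
    by apply: contraTneq aS0 => ->; exact: S0_not1.
  by case: Ng; rewrite g1 -(mulgV a); apply: in_sigma2; rewrite ?sub // eq_sym.
have [a [b [aS bS ab]]] : exists a b, [/\ a \in S0, b \in S0 & a != b].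
  by case/card_gt2P: S0gt2 => a [b [c [[aS bS _] [ab _ _]]]]; exists a, b.
have V x : x \in S0 -> x^-1 = x by move/invS0/negPn/eqP.
have ne1 x : x \in S0 -> x != 1 by apply: contraTneq => ->; exact: S0_not1.
have abS : a * b \in S0.
  by rewrite inS0 ?groupM ?subH // -eq_invg_mul V.
case: Ng; rewrite g1 -(mulgV (a * b)) (V (a * b)) //.
apply: in_sigma3; rewrite ?sub //.
- by rewrite -{1}(mulg1 a) (inj_eq (mulgI a)) eq_sym ne1.
- by rewrite -{1}(mul1g b) (inj_eq (mulIg b)) eq_sym ne1.
Qed.

Lemma critical_S0_1 : 3 < #|H| -> #|S0| = 1%N -> False.
Proof.
move=> cH cS0; have : #|S0| + #|S1| = #|H| by rewrite -card_S cS.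
rewrite cS0 add1n => E; have := card_S1_le; rewrite -E ltnSn => /(_ isT).
by rewrite card_K cS0 -ltnS E leqNgt cH.
Qed.

Lemma critical_S0_2 : 3 < #|H| -> #|S0| = 2%N -> False.
Proof.
move=> cH cS0; have : #|S0| + #|S1| = #|H| by rewrite -card_S cS.
rewrite cS0 => E.
have S1H : #|S1| < #|H| by rewrite -E addSn ltnS leq_addl.
have := card_S1_le S1H; rewrite card_K cS0 => S1le3.
have /eqP/cards2P[a [b [ab S0E]]] := cS0.
have ne1 x : x \in S0 -> x != 1 by apply: contraTneq => ->; exact: S0_not1.
have aS0 : a \in S0 by rewrite S0E !inE eqxx.
have bS0 : b \in S0 by rewrite S0E !inE eqxx orbT.
have [a1 b1] := (ne1 _ aS0, ne1 _ bS0).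
(* The product a b lies in K = {1, a, b} and can be neither factor. *)
have abE : b = a^-1.
  have := sigma_S0_in_K (in_sigma2 aS0 bS0 ab).
  rewrite /K S0E !inE => /or3P[]/eqP F.
  - by rewrite -[b](mulKg a) F mulg1.
  - by case/eqP: b1; apply: (mulgI a); rewrite mulg1.
  - by case/eqP: a1; apply: (mulIg b); rewrite mul1g.
have KE x : (x \in K) = [|| x == 1, x == a | x == a^-1].
  by rewrite /K S0E -abE !inE.
have [[aS aH] [bS bH]] := (setIP aS0, setIP bS0).
have gK : g \notin K.
  rewrite KE; apply/negP => /or3P[]/eqP gE; apply: Ng; rewrite gE.
  - by rewrite -(mulgV a) -abE; apply: in_sigma2.
  - exact: in_sigma1.
  - by rewrite -abE; apply: in_sigma1.
have [c cS1] : exists c, c \in S1 by apply: S1_neq0; rewrite cS.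
have cN := subsetP S1_outside _ cS1.
case/negP: nabG; have [H5|H4] : #|H| = 5 \/ #|H| = 4.
    by move: cH S1le3; rewrite -E; case: #|S1| => [|[|[|[|]]]] //; [right|left].
  (* If c^2 = 1, then g c^-1 c^-1 = g would lie in [K]. *)
  apply: (abelian_prime_index2 _ cN); first by rewrite H5.
  have := quotient_in_K cS1 cN; rewrite setD11 => /(_ isT).
  by apply: contraTneq => cc; rewrite -mulgA -invMg cc invg1 mulg1.
have abH : abelian H by apply: (@card_p2group_abelian _ 2).
apply: (abelian_index2 abH cN) => h hH.
(* With |H| = 4 and |K| = 3, [g] is the only element of [H] outside [K]. *)
have outer x : x \in H -> x \notin K -> x = g.
  have /eqP/cards1P[y HK] : #|H :\: K| = 1%N.
    by rewrite cardsD (setIidPr K_inside) card_K cS0 H4.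
  move=> yH yK; have : x \in H :\: K by rewrite inE yH yK.
  have : g \in H :\: K by rewrite inE gH gK.
  by rewrite HK => /set1P-> /set1P->.
have aV : a^-1 != a by rewrite -abE eq_sym.
have a4 : a * a * a * a = 1.
  by rewrite -(expg_cardG aH) H4 !expgS expg0 mulg1 !mulgA.
have aa1 : a * a != 1 by rewrite -eq_invg_mul.
have aa : a * a = g.
  apply: outer; first exact: groupM.
  rewrite KE !negb_or aa1 /=; apply/andP; split.
    by apply: contra_neq a1 => F; apply: (mulgI a); rewrite mulg1.
  by apply: contra_neq a1 => F; rewrite -a4 F mulVg mul1g.
have [d dS1 dc] : exists2 d, d \in S1 & d != c.
  have : 0 < #|S1 :\ c| by move: E; rewrite H4 (card_S1D1 cS1) => -[->].
  by case/card_gt0P => d /setD1P[dc dS1]; exists d.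
have dE : d = c^-1.
  have /outer F := quotient_notin_K dS1 cS1 dc.
  have cdH : g * c^-1 * d^-1 \in H.
    by rewrite -mulgA -invMg groupM ?groupV ?outsideM // (subsetP S1_outside).
  apply/esym/(mulIg d^-1); rewrite mulgV; apply: (mulgI g).
  by rewrite mulgA F // mulg1.
have [cS' cH''] := setDP cS1; have [dS dH] := setDP dS1.
have neH x y : x \in H -> y \notin H -> x != y.
  by move=> xH; apply: contraNneq => <-.
(* Since b = a^-1 and d = c^-1, this is a commutator of [a] and [c]. It lies in [H] and is not [g],
   so it is 1, a or a^-1. *)
have wS : in_sigma S (a * c * b * d).
  by apply: in_sigma4; rewrite ?(eq_sym c) // neH.
have wH : a * c * b * d \in H.
  rewrite abE dE -!mulgA groupM // mulgA.
  by rewrite outsideM ?insideMr ?groupV ?outsideV.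
have : a * c * b * d \in K.
  by apply/idPn => /(outer _ wH) wg; apply: Ng; rewrite -wg.
rewrite KE abE dE => /or3P[]/eqP F.
- have ca : commute c a by rewrite /commute -[LHS]mul1g -F !mulgA !mulgKV.
  have [hK|/(outer _ hH)->] := boolP (h \in K); last first.
    by rewrite -aa; apply: commuteM.
  move: hK; rewrite KE => /or3P[]/eqP-> //; first exact: commute1.
  exact: commuteV.
- have F' : c * a^-1 * c^-1 = 1 by apply: (mulgI a); rewrite !mulgA F mulg1.
  case/eqP: a1; rewrite -[a]invgK -(mulKg c a^-1) -(mulgK c^-1 (c * a^-1)).
  by rewrite F' mul1g invgK mulVg invg1.
(* Conjugation by [c] sends a^-1 to a^-2; squaring gives c a^-2 c^-1 = a^-4 = 1, against a^2 !=
   1. *)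
- have F' : c * a^-1 = a^-1 * a^-1 * c.
    apply: (mulgI a); apply: (mulIg c^-1).
    by rewrite !mulgA F mulgK mulgV mul1g.
  case/eqP: aa1; apply: invg_inj; rewrite invMg invg1.
  apply: (mulgI c); rewrite mulgA F' -mulgA F' !mulgA mulg1 -!invMg !mulgA.
  by rewrite a4 invg1 mul1g.
Qed.

End Critical.

Lemma sigma_full_half :
  3 < #|H| -> ~~ abelian G -> #|H| <= #|S| -> sigma_full G S.
Proof.
move=> cH nabG cS g gG.
have [gH|gH] := boolP (g \in H); last first.
  by apply: sigma_outside; rewrite // inE gH.
move: cS; rewrite leq_eqVlt => /orP[/eqP cS|cS]; last first.
  exact: sigma_inside_large.
apply: NNPP => Ng; have := critical_S0_large (esym cS) gH Ng.
have := @critical_S0_0 g (esym cS) gH Ng nabG cH.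
have := critical_S0_1 (esym cS) gH Ng cH.
have := critical_S0_2 (esym cS) gH Ng nabG cH.
case E: #|S0| => [|[|[|k]]] E2 E1 E0 E3; [|exact: E1|exact: E2|exact: E3].
by apply/E0/eqP; rewrite -cards_eq0 E.
Qed.

Lemma sigma_full_gt_half : #|H| < #|S| -> sigma_full G S.
Proof.
move=> cS g gG; have [gH|gH] := boolP (g \in H).
  exact: sigma_inside_large.
by apply: sigma_outside; [exact: ltnW | rewrite inE gH].
Qed.

End LargeSubset.

(** * Lower bounds for the critical number *)

Lemma cr_lower_half t : cr_prop G t -> #|H| <= t.
Proof.
move=> crt; rewrite leqNgt; apply/negP => tH.
have [g /setDP[gG gH]] : exists g, g \in G :\: H.
  by apply/card_gt0P; rewrite card_outside cardG_gt0.
(* The set [H :\ 1] has |H| - 1 elements and all its products stay in [H], so it misses [g]. *)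
have cH1 : t <= #|H :\ 1|.
  by rewrite -ltnS; move: tH; rewrite (cardsD1 1 H) group1.
have [s [_ _ sH gE]] := crt _ (setSD _ sHG) cH1 g gG.
case/negP: gH; rewrite gE big_seq; apply: group_prod => x /sH.
by case/setD1P.
Qed.

(* In the dihedral group of order 6, at most three distinct reflections never
   multiply to 1: an odd product is a reflection, and reflections are
   involutions. *)
Lemma cr_lower_order6 t : ~~ abelian G -> #|H| = 3 -> cr_prop G t -> 3 < t.
Proof.
move=> nabG cH crt; rewrite ltnNge; apply/negP => t3.
have cN : #|G :\: H| = 3 by rewrite card_outside.
have N1 : G :\: H \subset G :\ 1.
  by apply: setDS; rewrite sub1set group1.
have inv x : x \in G :\: H -> x * x = 1.
  move=> xN; apply/eqP; apply: contraNT nabG.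
  by apply: abelian_prime_index2 xN; rewrite cH.
have [s [us s0 sN]] := crt _ N1 (leq_trans t3 (eq_leq (esym cN))) 1 (group1 G).
have : size s <= 3.
  by rewrite -cN cardE; apply: uniq_leq_size => // x /sN; rewrite mem_enum.
have N x : x \in s -> x \notin H by case/sN/setDP.
have NN x : x \in s -> x \in G :\: H by apply: sN.
case: s us s0 sN N NN => [|x [|y [|z [|? ?]]]] //= us _ _ N NN _.
- by rewrite big_seq1 => E; have := N x (mem_head _ _); rewrite -E group1.
- rewrite !big_cons big_nil mulg1 => E; move: us.
  rewrite inE andbT => /eqP; case.
  by apply: (mulgI x); rewrite -E inv // NN ?mem_head.
- rewrite !big_cons big_nil mulg1 => E.
  have /negP[] := N x (mem_head _ _).
  rewrite -(mulgK (y * z) x) -E mul1g groupV.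
  by apply: outsideM; apply: NN; rewrite !inE eqxx ?orbT.
Qed.

End IndexTwo.

Theorem theorem1p3 (gT : finGroupType) (G : {group gT}) :
  ~~ abelian G -> ~~ odd #|G| ->
  (exists H : {group gT}, H \subset G /\ #|G : H|%g = 2) ->
  (#|G| = 6 -> is_cr G 4) /\ (#|G| <> 6 -> is_cr G (#|G| %/ 2)).
Proof.
move=> nabG _ [H [sHG iHG]]; have cG := card_index2 sHG iHG.
split=> nG.
  have cH : #|H| = 3 by apply: double_inj; rewrite -cG nG.
  split=> [S SG cS|t].
    by apply: (sigma_full_gt_half sHG iHG); rewrite ?cH.
  exact: cr_lower_order6 cH.
have -> : (#|G| %/ 2 = #|H|)%N by rewrite cG -muln2 mulnK.
have cH : 3 < #|H|.
  rewrite ltnNge; apply/negP => cH; case/negP: nabG.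
  (* |H| = 3 would give order 6; |H| = 1 or 2 gives order 2 or 4, hence an abelian [G]. *)
  case E: #|H| (cardG_gt0 H) cH cG nG => [|[|[|[|]]]] // _ _ cG //.
    by move=> _; apply/cyclic_abelian/prime_cyclic; rewrite cG.
  by move=> _; apply: (@card_p2group_abelian _ 2).
split=> [S SG cS|t]; first exact: (sigma_full_half sHG iHG).
exact: cr_lower_half.
Qed.
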